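(* In the setting described in the context (an invariant section $i$ of the bundle correspondence $H\sim(F,G)$ over $u$, and the associated invariant bundle map $f$ with maps $x_m$), assume: (a) the fibers of $X$ and $Y$ are Banach spaces; (b) for every $m\in M$, $F_m(\cdot)$ and $G_m(\cdot)$ are $C^1$; (c) $\sup_m\vartheta(m)\lambda_s(m)\lambda_u(m)<1$. Then: (1) There exists a unique vector bundle map $K^1\in L(\Upsilon^V_X,\Upsilon^V_Y)$ over $f$ (i.e. a family $K^1_m(x)\in L(X_m,Y_m)$, $x\in X_m$, $m\in M$) such that $|K^1_m(x)|\le\beta'(m)$ for all $m\in M$, $x\in X_m$, and such that, for suitable $R^1_m(x)\in L(X_m,X_{u(m)})$, $$DF_m(x,f_{u(m)}(x_m(x)))\big(\mathrm{id},K^1_{u(m)}(x_m(x))R^1_m(x)\big)=R^1_m(x),$$ $$DG_m(x,f_{u(m)}(x_m(x)))\big(\mathrm{id},K^1_{u(m)}(x_m(x))R^1_m(x)\big)=K^1_m(x).$$ (2) For every $m\in M$, $f_m:X_m\to Y_m$ is $C^1$ and $Df_m(x)=K^1_m(x)$.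
   Context: A bundle with metric fibers $(X,M,\pi)$ is a surjection $\pi:X\to M$ of sets whose fibers $X_m$ are complete metric spaces (metrics written $|x-y|$). $H\sim(F,G):X\times Y\to X\times Y$ is a bundle correspondence over $u:M\to M$ with generating bundle map: for each $m$ there are $F_m:X_m\times Y_{u(m)}\to X_{u(m)}$, $G_m:X_m\times Y_{u(m)}\to Y_m$ and $H_m$ is the relation $(x_2,y_2)\in H_m(x_1,y_1)\iff y_1=G_m(x_1,y_2),x_2=F_m(x_1,y_2)$. Conditions for $H_m$ (for all $(x_1,y_1)\times(x_2,y_2)$, $(x_1',y_1')\times(x_2',y_2')\in\operatorname{Graph}H_m$, functions evaluated at $m$): (A)$(\alpha;\alpha',\lambda_u)$: $|x_1-x_1'|\le\alpha|y_1-y_1'|$ implies $|x_2-x_2'|\le\alpha'|y_2-y_2'|$ and $|y_1-y_1'|\le\lambda_u|y_2-y_2'|$. (B)$(\beta;\beta',\lambda_s)$: $|y_2-y_2'|\le\beta|x_2-x_2'|$ implies $|y_1-y_1'|\le\beta'|x_1-x_1'|$ and $|x_2-x_2'|\le\lambda_s|x_1-x_1'|$. (A$'$)$(\alpha,\lambda_u)$: $\sup_x\operatorname{Lip}F_m(x,\cdot)\le\alpha$, $\sup_x\operatorname{Lip}G_m(x,\cdot)\le\lambda_u$. Setting: $X,Y$ are bundles with metric fibers over $M$, $u:M\to M$, $H\sim(F,G)$ is a bundle correspondence over $u$, and $i=(i_X,i_Y)$ is an invariant section: $F_m(i_X(m),i_Y(u(m)))=i_X(u(m))$, $G_m(i_X(m),i_Y(u(m)))=i_Y(m)$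 for all $m$. Either (I) $H$ satisfies (A$'$)$(\alpha,\lambda_u)$ (B)$(\beta;\beta',\lambda_s)$ with $\sup_m\alpha(m)\beta'(u(m))<1$, $\beta'(u(m))\le\beta(m)$, $\sup_m\{\alpha(m),\beta(m)\}<\infty$, in which case $\vartheta(m)=(1-\alpha(m)\beta'(u(m)))^{-1}$; or (II) $H$ satisfies (A)$(\alpha;\alpha',\lambda_u)$ (B)$(\beta;\beta',\lambda_s)$ with $\sup_m\alpha'(m)\beta'(u(m))<1$, $\alpha'(m)\le\alpha(u(m))$, $\beta'(u(m))\le\beta(m)$, $\sup_m\{\alpha(m),\beta(m)\}<\infty$, in which case $\vartheta\equiv1$. Moreover $\sup_m\vartheta(m)\lambda_s(m)\lambda_u(m)<1$. In this setting there is a unique bundle map $f:X\to Y$ over $\mathrm{id}$ (maps $f_m:X_m\to Y_m$) with $\operatorname{Lip}f_m\le\beta'(m)$, $f_m(i_X(m))=i_Y(m)$, and for which there are $x_m:X_m\to X_{u(m)}$ with $\operatorname{Lip}x_m\le\lambda_s(m)$ and $F_m(x,f_{u(m)}(x_m(x)))=x_m(x)$, $G_m(x,f_{u(m)}(x_m(x)))=f_m(x)$ for all $x\in X_m$; this $f$ and these $x_m$ are meant. When the fibers are Banach spaces, $\Upsilon^V_X$ is the vector bundle over $X$ with fiber $X_m$ at $(m,x)$, similarly $\Upsilon^V_Y$. *)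

(* Defs.v *)
From HB Require Import structures.
From mathcomp Require Import all_boot all_order all_algebra.
From mathcomp Require Import all_classical all_reals all_analysis.

Set Implicit Arguments.
Unset Strict Implicit.
Unset Printing Implicit Defensive.

Import Order.TTheory GRing.Theory Num.Theory.
Import numFieldNormedType.Exports.

Local Open Scope classical_set_scope.
Local Open Scope ring_scope.

(* The space L(V, W) of bounded linear operators. *)
Record bounded_op (R : realType) (V W : normedModType R) := BoundedOp {
  bounded_op_fun :> {linear V -> W};
  bounded_op_cont : continuous bounded_op_fun }.

Lemma bounded_op_ext (R : realType) (V W : normedModType R)
  (S T : bounded_op V W) : (forall v, S v = T v) -> S = T.
Proof.
case: S T => [S cS] [T cT] /= /funext ST.
have {}ST : S = T.
  case: S T ST {cS cT} => [S [[Sa] [Sb]]] [T [[Ta] [Tb]]] /= ST.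
  by subst T; rewrite (Prop_irrelevance Sa Ta) (Prop_irrelevance Sb Tb).
by subst T; rewrite (Prop_irrelevance cS cT).
Qed.

(* Extended-real valued, so that "opnorm T <= c" also expresses finiteness. *)
Definition opnorm (R : realType) (V W : normedModType R) (T : V -> W) : \bar R :=
  ereal_sup [set `|T v|%:E | v in [set v : V | `|v| <= 1]].

(* Everywhere Frechet differentiable, with the differential continuous for the
   operator norm. *)
Definition C1 (R : realType) (V W : normedModType R) (f : V -> W) : Prop :=
  (forall x, differentiable f x) /\
  (forall x, opnorm ('d f y \- 'd f x) @[y --> x] --> 0%E).

Section BundleCorrespondence.
Context {R : realType} {M : Type} {X Y : M -> normedModType R} {u : M -> M}.
Variable F : forall m, X m * Y (u m) -> X (u m).
Variable G : forall m, X m * Y (u m) -> Y m.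

Definition corr (m : M) (p : X m * Y m) (q : X (u m) * Y (u m)) : Prop :=
  p.2 = G (p.1, q.2) /\ q.1 = F (p.1, q.2).

Definition condA (alpha alpha' lambda_u : M -> R) : Prop :=
  forall m (x1 x1' : X m) (y1 y1' : Y m)
    (x2 x2' : X (u m)) (y2 y2' : Y (u m)),
  corr (x1, y1) (x2, y2) -> corr (x1', y1') (x2', y2') ->
  `|x1 - x1'| <= alpha m * `|y1 - y1'| ->
  `|x2 - x2'| <= alpha' m * `|y2 - y2'| /\
  `|y1 - y1'| <= lambda_u m * `|y2 - y2'|.

Definition condB (beta beta' lambda_s : M -> R) : Prop :=
  forall m (x1 x1' : X m) (y1 y1' : Y m)
    (x2 x2' : X (u m)) (y2 y2' : Y (u m)),
  corr (x1, y1) (x2, y2) -> corr (x1', y1') (x2', y2') ->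
  `|y2 - y2'| <= beta m * `|x2 - x2'| ->
  `|y1 - y1'| <= beta' m * `|x1 - x1'| /\
  `|x2 - x2'| <= lambda_s m * `|x1 - x1'|.

Definition condA' (alpha lambda_u : M -> R) : Prop :=
  forall m (x : X m),
  (alpha m).-lipschitz (fun y => F (x, y)) /\
  (lambda_u m).-lipschitz (fun y => G (x, y)).

Definition invariant_section (iX : forall m, X m) (iY : forall m, Y m) : Prop :=
  forall m, F (iX m, iY (u m)) = iX (u m) /\ G (iX m, iY (u m)) = iY m.

Definition invariant_map (beta' lambda_s : M -> R)
    (iX : forall m, X m) (iY : forall m, Y m)
    (f : forall m, X m -> Y m) (xm : forall m, X m -> X (u m)) : Prop :=
  forall m,
  [/\ (beta' m).-lipschitz (f m),
      f m (iX m) = iY m,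
      (lambda_s m).-lipschitz (xm m) &
      forall x, F (x, f (u m) (xm m x)) = xm m x /\
                G (x, f (u m) (xm m x)) = f m x].

Definition nonneg_fun (a : M -> R) : Prop := forall m, 0 <= a m.

Definition sup_fun (a : M -> R) : \bar R := ereal_sup (range (fun m => (a m)%:E)).

Definition hypI (alpha beta beta' lambda_s lambda_u theta : M -> R) : Prop :=
  [/\ condA' alpha lambda_u /\ condB beta beta' lambda_s,
      (sup_fun (fun m => alpha m * beta' (u m))%R < 1)%E,
      (forall m, beta' (u m) <= beta m),
      (sup_fun (fun m => Num.max (alpha m) (beta m)) < +oo)%E &
      (forall m, theta m = (1 - alpha m * beta' (u m))^-1)].

Definition hypII
    (alpha alpha' beta beta' lambda_s lambda_u theta : M -> R) : Prop :=
  [/\ condA alpha alpha' lambda_u /\ condB beta beta' lambda_s,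
      (sup_fun (fun m => alpha' m * beta' (u m))%R < 1)%E,
      (forall m, alpha' m <= alpha (u m)) /\ (forall m, beta' (u m) <= beta m),
      (sup_fun (fun m => Num.max (alpha m) (beta m)) < +oo)%E &
      (forall m, theta m = 1)].

(* [K m x] stands for K^1_m(x) : X_m -> Y_m, a map from the fiber of the
   vertical bundle over (m, x) to the fiber over (m, f_m(x)). *)
Definition invariant_derivative (beta' : M -> R)
    (f : forall m, X m -> Y m) (xm : forall m, X m -> X (u m))
    (K : forall m, X m -> bounded_op (X m) (Y m)) : Prop :=
  (forall m (x : X m), (opnorm (K m x) <= (beta' m)%:E)%E) /\
  exists Q : forall m, X m -> bounded_op (X m) (X (u m)),
  forall m (x : X m) (v : X m),
  'd (F (m := m)) (x, f (u m) (xm m x)) (v, K (u m) (xm m x) (Q m x v))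
    = Q m x v /\
  'd (G (m := m)) (x, f (u m) (xm m x)) (v, K (u m) (xm m x) (Q m x v))
    = K m x v.

End BundleCorrespondence.

(* Main.v *)
(* Conditions (A) and (B) pass to the differentials of F and G along the
   orbits of f, first for strict and then, by a perturbation which needs only
   alpha' beta' < 1, for closed cones.  Iterating them, the difference of two
   displacements with the same base component contracts like the product of the
   theta lambda_s lambda_u, up to errors which are negligible over finitely many
   steps.  Hence two families of approximate orbits ("pseudo-orbits") with the
   same base displacement agree to first order.  Applied to the Picard iterates
   of the linear graph transform this gives the existence of K; applied to the
   increments of f and to K it gives Df = K; applied to K at nearby base points
   it gives the continuity of K. *)
Require Import Defs.
From HB Require Import structures.
From mathcomp Require Import all_boot all_order all_algebra.
From mathcomp Require Import all_classical all_reals all_analysis.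
From mathcomp Require Import ring lra.

Set Implicit Arguments.
Unset Strict Implicit.
Unset Printing Implicit Defensive.

Import Order.TTheory GRing.Theory Num.Theory.
Import numFieldNormedType.Exports.

Local Open Scope classical_set_scope.
Local Open Scope ring_scope.

(** * Operator norms, differentials, and the passage of cone conditions to differentials *)

Section BoundedLinearMaps.
Context {R : realType} {V W : normedModType R}.

Lemma opnorm_leP (T : {linear V -> W}) (c : R) : 0 <= c ->
  (opnorm T <= c%:E)%E <-> forall v, `|T v| <= c * `|v|.
Proof.
move=> c0; split=> [Tc v|Tc].
  have [->|v0] := eqVneq v 0; first by rewrite linear0 !normr0 mulr0.
  have nv : 0 < `|v| by rewrite normr_gt0.
  rewrite -ler_pdivrMr// mulrC.
  have -> : `|v|^-1 * `|T v| = `|T (`|v|^-1 *: v)|.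
    by rewrite linearZ normrZ ger0_norm// invr_ge0.
  rewrite -lee_fin; apply: le_trans Tc; apply: ereal_sup_ubound => /=.
  exists (`|v|^-1 *: v) => //=.
  by rewrite normrZ normfV normr_id mulVf// normr_eq0.
apply: ge_ereal_sup => _ [v /= v1 <-]; rewrite lee_fin.
by apply: le_trans (Tc v) _; rewrite ler_piMr.
Qed.

Lemma bounded_op_of_map (g : V -> W) (c : R) :
  linear g -> (forall v, `|g v| <= c * `|v|) ->
  {T : bounded_op V W | T = g :> (V -> W)}.
Proof.
move=> glin gc.
pose gM := GRing.isLinear.Build _ _ _ _ g glin.
pose gL : {linear V -> W} := HB.pack g gM.
have cg : continuous gL.
  apply: bounded_linear_continuous; apply/linear_boundedP.
  apply: filterS (nbhs_pinfty_ge (num_real c)) => r cr v.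
  by apply: le_trans (gc v) _; exact: ler_wpM2r.
by exists (BoundedOp cg).
Qed.

Lemma differentiable_norm_le (f : V -> W) (x : V) : differentiable f x ->
  forall e, 0 < e -> exists2 d, 0 < d &
  forall h, `|h| <= d -> `|f (x + h) - f x - 'd f x h| <= e * `|h|.
Proof.
move=> df e e0; have /eqaddoP/(_ _ e0) := diff_locally df.
move=> /nbhs_norm0P[d /= d0 kd]; exists (d / 2); first by rewrite divr_gt0.
move=> h hd.
have := kd h; rewrite !fctE /= [h + x]addrC opprD addrA; apply.
by apply: le_lt_trans hd _; rewrite ltr_pdivrMr// ltr_pMr// ltr1n.
Qed.

Lemma differentiable_of_norm_le (f : V -> W) (T : {linear V -> W}) (x : V) :
  continuous T ->
  (forall e, 0 < e -> exists2 d, 0 < d &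
    forall h, `|h| <= d -> `|f (x + h) - f x - T h| <= e * `|h|) ->
  differentiable f x /\ 'd f x = T :> (V -> W).
Proof.
move=> cT fT.
have fo : f \o shift x = cst (f x) + T +o_ 0 id.
  apply: eqaddoE; apply/eqaddoP => e e0.
  have [d d0 fd] := fT _ e0; apply/nbhs_norm0P; exists d => //= h hd.
  rewrite !fctE /= [h + x]addrC opprD addrA.
  by apply: fd; exact: ltW.
have dE := diff_unique cT fo.
split=> //; apply/diff_locallyP; rewrite dE; split=> //.
Qed.

Lemma C1_norm_le (f : V -> W) (x : V) : C1 f ->
  forall e, 0 < e -> exists2 d, 0 < d &
  forall y, `|y - x| <= d -> forall v, `|'d f y v - 'd f x v| <= e * `|v|.
Proof.
move=> [fd fc] e e0; have /fine_cvgP[fin /cvgrPdist_le/(_ _ e0)] := fc x.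
move=> near_e.
have /nbhs_normP[d /= d0 H] : \forall y \near x,
    (opnorm ('d f y \- 'd f x)%R <= e%:E)%E.
  near=> y.
  have fy : opnorm ('d f y \- 'd f x) \is a fin_num by near: y; exact: fin.
  rewrite -(fineK fy) lee_fin; apply: le_trans (ler_norm _) _.
  by rewrite -normrN -sub0r; near: y.
exists (d / 2); first by rewrite divr_gt0.
move=> y yd v.
have /H : ball_ (fun z => `|z|) x d y.
  rewrite /= distrC; apply: le_lt_trans yd _.
  by rewrite ltr_pdivrMr// ltr_pMr// ltr1n.
by move=> /(opnorm_leP ('d f y \- 'd f x) (ltW e0)); apply.
Unshelve. all: by end_near. Qed.

Lemma cvg_opnorm0 (T : V -> {linear V -> W}) (x : V) :
  (forall e, 0 < e -> exists2 d, 0 < d &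
    forall y, `|y - x| <= d -> forall v, `|T y v| <= e * `|v|) ->
  opnorm (T y) @[y --> x] --> 0%E.
Proof.
move=> HT.
have op0 y : (0 <= opnorm (T y))%E.
  apply: le_trans (ereal_sup_ubound _) => /=; last first.
    by exists 0 => //=; rewrite normr0 ler01.
  by rewrite lee_fin.
have Hn e : 0 < e -> \forall y \near x, (opnorm (T y) <= e%:E)%E.
  move=> e0; have [d d0 Hd] := HT _ e0; apply/nbhs_normP; exists d => //= y yd.
  by apply/opnorm_leP; [exact: ltW|apply: Hd; rewrite distrC ltW].
have fin e y : (opnorm (T y) <= e%:E)%E -> opnorm (T y) \is a fin_num.
  move=> oe; rewrite ge0_fin_numE//; apply: le_lt_trans oe _; exact: ltry.
apply/fine_cvgP; split.
  by apply: filterS (Hn 1 ltr01) => y; exact: fin.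
apply/cvgrPdist_le => e e0; apply: filterS (Hn e e0) => y oe.
rewrite sub0r normrN ger0_norm ?fine_ge0// -lee_fin fineK//; exact: fin oe.
Qed.

End BoundedLinearMaps.

Lemma sup_fun_lt (R : realType) (M : Type) (g : M -> R) (c : \bar R) :
  (sup_fun g < c)%E -> exists2 r : R, (r%:E < c)%E & forall m, g m <= r.
Proof.
rewrite /sup_fun => gc.
have ub m : ((g m)%:E <= ereal_sup (range (fun m => (g m)%:E)))%E.
  by apply: ereal_sup_ubound; exists m.
case E : (ereal_sup _) gc ub => [r| |] gc ub.
- by exists r => // m; rewrite -lee_fin.
- by rewrite ltNge leey in gc.
(* The supremum is [-oo] only for empty [M]; any real below [c] then serves. *)
- have noM (m : M) : False by have := ub m; rewrite leeNy_eq.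
  have [r rc] : exists r : R, (r%:E < c)%E.
    case: c gc => [c| |]// _; last by exists 0; rewrite ltry.
    by exists (c - 1); rewrite lte_fin ltrBlDr ltrDl.
  by exists r => // m; case: (noM m).
Qed.

(** Apply the increment condition to [t *: v] and divide by a small [t]: strictness of the cone
    absorbs the error of the linear approximation of [phi], and when [N1 v = 0] the premise holds
    trivially. In the applications [N1] and [N2] are the norms of the two components of a pair. *)
Lemma differentiable_cone (R : realType) (Z V W : normedModType R)
    (phi : Z -> V) (psi : Z -> W) (p : Z) (N1 N2 : Z -> R) (c d : R) :
  differentiable phi p -> differentiable psi p -> 0 <= c ->
  (forall (t : R) v, 0 < t -> N1 (t *: v) = t * N1 v) ->
  (forall (t : R) v, 0 < t -> N2 (t *: v) = t * N2 v) ->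
  (forall h, N1 h <= c * `|phi (p + h) - phi p| ->
    `|psi (p + h) - psi p| <= d * N2 h) ->
  forall v, N1 v = 0 \/ N1 v < c * `|'d phi p v| ->
  `|'d psi p v| <= d * N2 v.
Proof.
move=> dphi dpsi c0 N1Z N2Z cone v Nv; apply/ler_addgt0Pr => /= e e0.
(* [e'] is the tolerance for both linear approximations, small enough for [c * e'] to fit into the
   gap of the strict inequality. *)
have [e' [e'0 e'e Ne']] : exists e' : R, [/\ 0 < e', e' <= e &
    N1 v = 0 \/ N1 v + c * e' <= c * `|'d phi p v|].
  case: Nv => [N0|Nlt]; first by exists e; split=> //; left.
  exists (Num.min e ((c * `|'d phi p v| - N1 v) / (c + 1))); split.
  - by rewrite lt_min e0 divr_gt0// ?subr_gt0//; lra.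
  - by rewrite ge_min lexx.
  - right; rewrite -lerBrDl.
    apply: (@le_trans _ _ (c * ((c * `|'d phi p v| - N1 v) / (c + 1)))).
      by apply: ler_wpM2l => //; rewrite ge_min lexx orbT.
    rewrite mulrCA ler_piMr//; first by rewrite subr_ge0 ltW.
    by rewrite ler_pdivrMr; lra.
have v1 : 0 < `|v| + 1 by rewrite ltr_wpDl.
have e1 : 0 < e' / (`|v| + 1) by rewrite divr_gt0.
have [d1 d10 H1] := differentiable_norm_le dphi e1.
have [d2 d20 H2] := differentiable_norm_le dpsi e1.
pose t : R := Num.min d1 d2 / (`|v| + 1).
have t0 : 0 < t by rewrite divr_gt0// lt_min d10.
have tv : `|t *: v| <= Num.min d1 d2.
  rewrite normrZ gtr0_norm// /t mulrAC ler_pdivrMr//.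
  by apply: ler_wpM2l; rewrite ?lerDl// le_min !ltW.
clearbody t.
have small : e' / (`|v| + 1) * `|t *: v| <= e' * t.
  have -> : e' / (`|v| + 1) * `|t *: v| = e' * (t * `|v|) / (`|v| + 1).
    by rewrite normrZ gtr0_norm// mulrAC.
  rewrite ler_pdivrMr// -mulrA.
  apply: ler_wpM2l; first exact: ltW.
  by apply: ler_wpM2l; [exact: ltW|rewrite lerDl].
have {}H1 : `|phi (p + t *: v) - phi p - t *: 'd phi p v| <= e' * t.
  by rewrite -linearZ; apply: le_trans (H1 _ _) small; move: tv; rewrite le_min => /andP[].
have {}H2 : `|psi (p + t *: v) - psi p - t *: 'd psi p v| <= e' * t.
  by rewrite -linearZ; apply: le_trans (H2 _ _) small; move: tv; rewrite le_min => /andP[].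
have psi_le : `|psi (p + t *: v) - psi p| <= d * (t * N2 v).
  rewrite -N2Z//; apply: cone; rewrite N1Z//.
  case: Ne' => [->|Ne']; first by rewrite mulr0 mulr_ge0.
  have := ler_distD 0 (t *: 'd phi p v) (phi (p + t *: v) - phi p).
  rewrite subr0 sub0r normrN.
  have : `|t *: 'd phi p v| <= `|phi (p + t *: v) - phi p| + e' * t.
    rewrite -lerBlDl; apply: le_trans (lerB_dist _ _) _.
    by rewrite distrC.
  rewrite normrZ gtr0_norm// => H _.
  have {}H : c * (t * `|'d phi p v|) <= c * (`|phi (p + t *: v) - phi p| + e' * t).
    exact: ler_wpM2l.
  have := ler_wpM2l (ltW t0) Ne'; lra.
have : t * `|'d psi p v| <= t * (d * N2 v + e').
  have -> : t * `|'d psi p v| = `|t *: 'd psi p v| by rewrite normrZ gtr0_norm.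
  have : `|t *: 'd psi p v| <= `|psi (p + t *: v) - psi p| + e' * t.
    rewrite -lerBlDl; apply: le_trans (lerB_dist _ _) _.
    by rewrite distrC.
  lra.
rewrite ler_pM2l// => /le_trans; apply; lra.
Qed.

(** * Linear correspondences: perturbed cone conditions and the graph transform *)

Section LinearCorrespondence.
Context {R : realType} {X0 Y0 X1 Y1 : normedModType R}.
Context (A : {linear (X0 * Y1)%type -> X1}) (B : {linear (X0 * Y1)%type -> Y0}).
Context (al a' lu be b' b1 ls : R).
Context (a'0 : 0 <= a') (lu0 : 0 <= lu) (b'0 : 0 <= b') (ls0 : 0 <= ls).
Context (b10 : 0 <= b1) (b1be : b1 <= be) (a'b1 : a' * b1 < 1).
Context (coneA : forall v w, `|v| = 0 \/ `|v| < al * `|B (v, w)| ->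
  `|A (v, w)| <= a' * `|w| /\ `|B (v, w)| <= lu * `|w|).
Context (coneB : forall v w, `|w| = 0 \/ `|w| < be * `|A (v, w)| ->
  `|B (v, w)| <= b' * `|v| /\ `|A (v, w)| <= ls * `|v|).

Lemma linear_pairD (U : normedModType R) (T : {linear (X0 * Y1)%type -> U}) v w v' w' :
  T (v + v', w + w') = T (v, w) + T (v', w').
Proof. by rewrite -linearD. Qed.

Lemma linear_pairB (U : normedModType R) (T : {linear (X0 * Y1)%type -> U}) v w v' w' :
  T (v - v', w - w') = T (v, w) - T (v', w').
Proof. by rewrite -linearB. Qed.

Lemma linear_pairP (U : normedModType R) (T : {linear (X0 * Y1)%type -> U})
    k v w v' w' :
  T (k *: v + v', k *: w + w') = k *: T (v, w) + T (v', w').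
Proof. by rewrite -linearP. Qed.

Lemma corrA0 w : `|A (0, w)| <= a' * `|w| /\ `|B (0, w)| <= lu * `|w|.
Proof. by apply: coneA; left; rewrite normr0. Qed.

Lemma corrB0 v : `|B (v, 0)| <= b' * `|v| /\ `|A (v, 0)| <= ls * `|v|.
Proof. by apply: coneB; left; rewrite normr0. Qed.

(* [coneB] is only about strict cones, so [w] is first shrunk to [(1 - t) w]. *)
Lemma corrB v w : `|w| <= b1 * `|A (v, w)| ->
  `|B (v, w)| <= b' * `|v| /\ `|A (v, w)| <= ls * `|v|.
Proof.
move=> wA; have [w0|w0] := eqVneq `|w| 0; first by apply: coneB; left.
have {}w0 : 0 < `|w| by rewrite lt_def w0 normr_ge0.
have key t : 0 < t -> t <= 1 ->
    `|B (v, w)| <= b' * `|v| + t * (lu * `|w|) /\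
    `|A (v, w)| <= ls * `|v| + t * (a' * `|w|).
  move=> t0 t1.
  have wE : (v, w) = (v, (1 - t) *: w) + t *: (0, w).
    apply: injective_projections => /=; first by rewrite scaler0 addr0.
    by rewrite scalerBl scale1r subrK.
  have [A0 B0] := corrA0 w.
  have lin (U : normedModType R) (T : {linear (X0 * Y1)%type -> U}) :
      T (v, w) = T (v, (1 - t) *: w) + t *: T (0, w).
    by rewrite [in LHS]wE linearD linearZ.
  have le1 (U : normedModType R) (T : {linear (X0 * Y1)%type -> U}) :
      `|T (v, w)| <= `|T (v, (1 - t) *: w)| + t * `|T (0, w)|.
    by rewrite lin; apply: le_trans (ler_normD _ _) _; rewrite normrZ gtr0_norm.
  have tA : t * `|A (0, w)| <= t * (a' * `|w|) by rewrite ler_pM2l.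
  have tB : t * `|B (0, w)| <= t * (lu * `|w|) by rewrite ler_pM2l.
  have [|BB AA] := coneB (v := v) (w := (1 - t) *: w).
    right; rewrite normrZ ger0_norm; last lra.
    have := le1 _ A => leA.
    apply: (@lt_le_trans _ _ (b1 * `|A (v, (1 - t) *: w)|)); last exact: ler_wpM2r.
    have H : b1 * `|A (v, w)| <= b1 * (`|A (v, (1 - t) *: w)| + t * (a' * `|w|)).
      by apply: ler_wpM2l => //; lra.
    (* Shrinking lowers the norm of [w] by [t * |w|] but [b1 * |A (v, w)|] by at most
       [a' * b1 * t * |w|]; the difference makes the inequality strict. *)
    have : 0 < (1 - a' * b1) * (t * `|w|) by rewrite mulr_gt0 ?mulr_gt0// subr_gt0.
    lra.
  have := le1 _ A; have := le1 _ B; lra.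
have lim0 (x y k : R) : 0 <= k ->
    (forall t, 0 < t -> t <= 1 -> x <= y + t * k) -> x <= y.
  move=> k0 H; apply/ler_addgt0Pr => e e0.
  have k1 : 0 < k + 1 by lra.
  have t0 : 0 < Num.min 1 (e / (k + 1)) by rewrite lt_min ltr01 divr_gt0.
  apply: le_trans (H _ t0 _) _; first by rewrite ge_min lexx.
  rewrite lerD2l; apply: (@le_trans _ _ (e / (k + 1) * k)).
    by rewrite ler_wpM2r// ge_min lexx orbT.
  by rewrite mulrAC ler_pdivrMr// ler_pM2l//; lra.
split; [apply: (lim0 _ _ (lu * `|w|))|apply: (lim0 _ _ (a' * `|w|))];
  rewrite ?mulr_ge0// => t t0 t1; by have [] := key _ t0 t1.
Qed.

(* A pseudo-orbit slightly outside of the cone [|v| <= c |y|] is moved into its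
   interior by shrinking [v]; here [c b' < 1] is what makes this work. *)
Lemma corrA_robust (c : R) : 0 <= c -> c <= al -> c * b' < 1 ->
  exists2 N, 0 <= N & forall e v w x y, 0 < e ->
  `|v| <= c * `|y| + e -> `|x - A (v, w)| <= e -> `|y - B (v, w)| <= e ->
  `|x| <= a' * `|w| + N * e /\ `|y| <= lu * `|w| + N * e.
Proof.
(* Removing a piece [r] of norm [D * e] from [v] gains [D * e] and costs at most [c * b' * D * e]
   through [B (r, 0)]. The net gain [2 * (1 + c) * e] strictly exceeds the total error
   [(1 + c) * e]. If [v] is itself shorter than [D * e], all of it is removed. *)
move=> c0 cal cb'; pose D := 2 * (1 + c) / (1 - c * b').
have D0 : 0 <= D by rewrite divr_ge0//; lra.
have DE : D * (1 - c * b') = 2 * (1 + c) by rewrite divfK// gt_eqF// subr_gt0.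
exists ((ls + b') * D + 1).
  by rewrite addr_ge0// mulr_ge0// addr_ge0.
move=> e v w x y e0 vy xA yB.
have [r [vr rD]] : exists r,
    (`|v - r| = 0 \/ `|v - r| < al * `|B (v - r, w)|) /\ `|r| <= D * e.
  have [vD|vD] := leP `|v| (D * e).
    by exists v; split=> //; left; rewrite subrr normr0.
  have v0 : 0 < `|v| by apply: le_lt_trans vD; rewrite mulr_ge0// ltW.
  pose t := D * e / `|v|.
  have t0 : 0 <= t by rewrite divr_ge0// mulr_ge0// ltW.
  have t1 : t < 1 by rewrite ltr_pdivrMr// mul1r.
  have tv : t * `|v| = D * e by rewrite divfK// gt_eqF.
  have rE : `|t *: v| = D * e by rewrite normrZ ger0_norm.
  exists (t *: v); split; last by rewrite rE.
  right; rewrite -[X in X - t *: v]scale1r -scalerBl normrZ ger0_norm; last lra.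
  rewrite mulrBl mul1r tv.
  apply: (@lt_le_trans _ _ (c * `|B ((1 - t) *: v, w)|)); last exact: ler_wpM2r.
  have BE : B (v, w) = B ((1 - t) *: v, w) + B (t *: v, 0).
    by rewrite -linear_pairD addr0 -scalerDl subrK scale1r.
  have Bt : `|B (t *: v, 0)| <= b' * (D * e) by rewrite -rE; case: (corrB0 (t *: v)).
  have yle : `|y| <= `|B ((1 - t) *: v, w)| + b' * (D * e) + e.
    have := ler_normD (y - B (v, w)) (B (v, w)); rewrite subrK.
    have := ler_normD (B ((1 - t) *: v, w)) (B (t *: v, 0)); rewrite -BE; lra.
  have := ler_wpM2l c0 yle.
  have : 0 < e * (1 + c) by rewrite mulr_gt0//; lra.
  have := congr1 ( *%R e) DE; lra.
have [AA BB] := coneA vr.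
have [Br Ar] := corrB0 r.
have AE : A (v, w) = A (v - r, w) + A (r, 0) by rewrite -linear_pairD addr0 subrK.
have BE : B (v, w) = B (v - r, w) + B (r, 0) by rewrite -linear_pairD addr0 subrK.
have := ler_normD (A (v - r, w)) (A (r, 0)); rewrite -AE.
have := ler_normD (B (v - r, w)) (B (r, 0)); rewrite -BE.
have := ler_normD (y - B (v, w)) (B (v, w)); rewrite subrK.
have := ler_normD (x - A (v, w)) (A (v, w)); rewrite subrK.
have := ler_wpM2l ls0 rD; have := ler_wpM2l b'0 rD.
have : 0 <= ls * (D * e) by rewrite mulr_ge0// mulr_ge0// ltW.
have : 0 <= b' * (D * e) by rewrite mulr_ge0// mulr_ge0// ltW.
by move=> *; split; lra.
Qed.

End LinearCorrespondence.

(** For fixed [v] the map sending [w] to [A (v, K w)] contracts by [a' * b1], and [Q v] is its fixed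
    point. Uniqueness of fixed points makes [Q] linear, and the cone condition at the fixed point
    gives both bounds. *)
Lemma graph_transform (R : realType) (X0 Y0 Y1 : normedModType R)
    (X1 : completeNormedModType R)
    (A : {linear (X0 * Y1)%type -> X1}) (B : {linear (X0 * Y1)%type -> Y0})
    (K : bounded_op X1 Y1) (a' b1 b' ls : R) :
  0 <= a' -> 0 <= b1 -> a' * b1 < 1 ->
  (forall w, `|A (0, w)| <= a' * `|w|) ->
  (forall v w, `|w| <= b1 * `|A (v, w)| ->
    `|B (v, w)| <= b' * `|v| /\ `|A (v, w)| <= ls * `|v|) ->
  (forall w, `|K w| <= b1 * `|w|) ->
  exists (Q : bounded_op X0 X1) (L : bounded_op X0 Y0), forall v,
  [/\ A (v, K (Q v)) = Q v, B (v, K (Q v)) = L v,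
      `|Q v| <= ls * `|v| & `|L v| <= b' * `|v|].
Proof.
move=> a'0 b10 ab1 A0 coneB Kb1.
have contr v w w' : `|A (v, K w) - A (v, K w')| <= a' * b1 * `|w - w'|.
  rewrite -linear_pairB subrr -linearB; apply: le_trans (A0 _) _.
  by rewrite -mulrA; exact: ler_wpM2l.
have fixuniq v w w' : A (v, K w) = w -> A (v, K w') = w' -> w = w'.
  move=> wE w'E; apply/eqP; rewrite -subr_eq0 -normr_le0.
  have := contr v w w'; rewrite wE w'E => H.
  have : (1 - a' * b1) * `|w - w'| <= 0 by rewrite mulrBl mul1r subr_le0.
  by rewrite pmulr_rle0// subr_gt0.
have fixex v : exists w, A (v, K w) = w.
  have fT : set_fun [set: X1] [set: X1] (fun w => A (v, K w)) by [].
  have ctr : is_contraction (mkfun fT).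
    have ab0 : 0 <= a' * b1 by exact: mulr_ge0.
    by exists (NngNum ab0); split=> //= -[w w'] _; exact: contr.
  have [||w _ wE] := banach_fixed_point ctr; first exact: closedT.
  - by exists 0.
  - by exists w; rewrite [RHS]wE.
have [Q QE] := choice fixex.
have bd v : `|B (v, K (Q v))| <= b' * `|v| /\ `|Q v| <= ls * `|v|.
  by rewrite -[X in _ /\ `|X| <= _]QE; apply: coneB; rewrite QE.
have Qlin : linear Q.
  move=> k v v'; apply: (fixuniq (k *: v + v')); first exact: QE.
  by rewrite linearP linear_pairP !QE.
have [Q' Q'E] := bounded_op_of_map Qlin (fun v => (bd v).2).
have Llin : linear (fun v => B (v, K (Q v))).
  by move=> k v v'; rewrite Qlin linearP linear_pairP.
have [L LE] := bounded_op_of_map Llin (fun v => (bd v).1).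
exists Q', L => v; rewrite LE Q'E; case: (bd v) => ? ?; split=> //.
Qed.

(** The limit is taken pointwise; the Cauchy estimate is uniform relative to [|v|], so it survives
    the limit in [l]. *)
Lemma bounded_op_complete (R : realType) (V : normedModType R)
    (W : completeNormedModType R) (T : nat -> bounded_op V W) (c : R) :
  (forall k v, `|T k v| <= c * `|v|) ->
  (forall e, 0 < e -> exists N, forall k l, (N <= k)%N -> (N <= l)%N ->
    forall v, `|T k v - T l v| <= e * `|v|) ->
  exists L : bounded_op V W, (forall v, `|L v| <= c * `|v|) /\
  forall e, 0 < e -> exists N, forall k, (N <= k)%N ->
    forall v, `|T k v - L v| <= e * `|v|.
Proof.
move=> Tc Tcauchy.
have Tcvg v : cvg (T k v @[k --> \oo]).
  apply/cauchy_cvgP/cauchy_exP => e e0.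
  have v1 : 0 < `|v| + 1 by rewrite ltr_wpDl.
  have [N HN] := Tcauchy _ (divr_gt0 e0 v1).
  exists (T N v), N => // k /= Nk; rewrite -ball_normE /=.
  apply: le_lt_trans (HN _ _ (leqnn N) Nk v) _.
  by rewrite mulrAC ltr_pdivrMr// ltr_pM2l// ltrDl.
pose g v := lim (T k v @[k --> \oo]).
have gE v : T k v @[k --> \oo] --> g v by exact: Tcvg.
have glin : linear g.
  move=> k v v'; apply/cvg_lim => //.
  under eq_fun do rewrite linearP.
  by apply: cvgD; [apply: cvgZl_tmp|]; exact: gE.
have gc v : `|g v| <= c * `|v|.
  by apply: (cvgr_to_le (cvg_norm (gE v))); exact: nearW.
have [L LE] := bounded_op_of_map glin gc.
exists L; rewrite LE; split=> // e e0; have [N HN] := Tcauchy _ e0.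
exists N => k Nk v.
have cv : `|T k v - T l v| @[l --> \oo] --> `|T k v - g v|.
  by apply: cvg_norm; apply: cvgB; [exact: cvg_cst|exact: gE].
apply: (cvgr_to_le cv).
by exists N => // l Nl; exact: HN.
Qed.

Lemma small_pos (R : realType) (d k c : R) : 0 < d -> 0 < k -> 0 <= c ->
  exists e, [/\ 0 < e, e <= d & c * e <= k].
Proof.
move=> d0 k0 c0; have c1 : 0 < c + 1 by rewrite ltr_wpDl.
exists (Num.min d (k / (c + 1))); split.
- by rewrite lt_min d0 divr_gt0.
- by rewrite ge_min lexx.
- apply: (@le_trans _ _ (c * (k / (c + 1)))).
    by apply: ler_wpM2l => //; rewrite ge_min lexx orbT.
  by rewrite mulrCA ler_piMr ?(ltW k0)// ler_pdivrMr// mul1r lerDl.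
Qed.

Lemma ler_dist_dist2 (R : realType) (V : normedModType R) (p1 p2 r1 r2 : V) (c : R) :
  `|p1 - r1| <= c -> `|p2 - r2| <= c -> `|p1 - p2 - (r1 - r2)| <= 2 * c.
Proof.
move=> H1 H2; have -> : p1 - p2 - (r1 - r2) = (p1 - r1) - (p2 - r2).
  by rewrite !opprB addrACA [RHS]addrACA [- p2 - r1]addrC.
by have := ler_normB (p1 - r1) (p2 - r2); lra.
Qed.

(** * Tangent cone conditions along the invariant graph *)

Section InvariantGraph.
Context {R : realType} {M : Type} {X Y : M -> completeNormedModType R}
  {u : M -> M}.
Context (F : forall m, (X m * Y (u m))%type -> X (u m))
  (G : forall m, (X m * Y (u m))%type -> Y m).
Context (a a' b b' ls lu th : M -> R) (q C : R).
Context (f : forall m, X m -> Y m) (xm : forall m, X m -> X (u m)).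
Context (a0 : nonneg_fun a) (a'0 : nonneg_fun a') (b'0 : nonneg_fun b')
  (lu0 : nonneg_fun lu) (ls0 : forall m, 0 < ls m).
Context (cA : condA F G a a' lu) (cB : condB F G b b' ls).
Context (a'b' : forall m, a' m * b' (u m) < 1) (b'b : forall m, b' (u m) <= b m).
Context (b'C : forall m, b' (u m) <= C).
Context (q0 : 0 <= q) (q1 : q < 1) (thq : forall m, th m * ls m * lu m <= q).
(** A common form of the two alternatives: either the cones are nested along [u] and no factor is
    lost, or they need not be nested and the loss is the inverse of the gap. *)
Context (thE : forall m, (a' m <= a (u m) /\ th m = 1) \/
                         (th m = (1 - a' m * b' (u m))^-1)).
Context (fE : forall m x, F (x, f (xm x)) = xm x /\ G (x, f (xm x)) = f x :> Y m).
Context (flip : forall m (x x' : X m), `|f x - f x'| <= b' m * `|x - x'|).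
Context (xmlip : forall m (x x' : X m), `|xm x - xm x'| <= ls m * `|x - x'|).
Context (FC1 : forall m, C1 (@F m)) (GC1 : forall m, C1 (@G m)).

Local Notation DF x := ('d (@F _) (x, f (xm x))).
Local Notation DG x := ('d (@G _) (x, f (xm x))).

Let bm0 m : 0 <= b m. Proof. exact: le_trans (b'b m). Qed.

Let th0 m : 0 < th m.
Proof.
by case: (thE m) => [[_ ->]//|->]; rewrite invr_gt0 subr_gt0.
Qed.

Let FC1' m (x : X m) : differentiable (@F m) (x, f (xm x)).
Proof. by case: (FC1 m). Qed.

Let GC1' m (x : X m) : differentiable (@G m) (x, f (xm x)).
Proof. by case: (GC1 m). Qed.

Lemma pair_norm_le (m : M) (v : X m) (w : Y (u m)) (c : R) :
  `|v| <= c -> `|w| <= c -> `|(v, w)| <= c.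
Proof. by move=> vc wc; rewrite prod_normE ge_max vc. Qed.

(** Condition (A), for the graph points determined by [(x, f (xm x))] and its translate by [h], is
    the increment condition of [differentiable_cone]. *)
Lemma tangentA m (x v : X m) (w : Y (u m)) :
  `|v| = 0 \/ `|v| < a m * `|DG x (v, w)| ->
  `|DF x (v, w)| <= a' m * `|w| /\ `|DG x (v, w)| <= lu m * `|w|.
Proof.
have inc h := @cA m (x + h.1) x (G ((x, f (xm x)) + h)) (G (x, f (xm x)))
  (F ((x, f (xm x)) + h)) (F (x, f (xm x))) (f (xm x) + h.2) (f (xm x))
  (conj erefl erefl) (conj erefl erefl).
have Nfst (t : R) (z : (X m * Y (u m))%type) : 0 < t -> `|(t *: z).1| = t * `|z.1|.
  by move=> t0; rewrite normrZ gtr0_norm.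
have Nsnd (t : R) (z : (X m * Y (u m))%type) : 0 < t -> `|(t *: z).2| = t * `|z.2|.
  by move=> t0; rewrite normrZ gtr0_norm.
have {}inc h : `|h.1| <= a m * `|G ((x, f (xm x)) + h) - G (x, f (xm x))| ->
    `|F ((x, f (xm x)) + h) - F (x, f (xm x))| <= a' m * `|h.2| /\
    `|G ((x, f (xm x)) + h) - G (x, f (xm x))| <= lu m * `|h.2|.
  by have := inc h; rewrite [x + _ - _]addrC addKr [f _ + _ - _]addrC addKr.
move=> vw; split.
- exact: (differentiable_cone (GC1' x) (FC1' x) (a0 m) Nfst Nsnd
    (fun h hh => (inc h hh).1) (v := (v, w)) vw).
- exact: (differentiable_cone (GC1' x) (GC1' x) (a0 m) Nfst Nsnd
    (fun h hh => (inc h hh).2) (v := (v, w)) vw).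
Qed.

Lemma tangentB m (x v : X m) (w : Y (u m)) :
  `|w| = 0 \/ `|w| < b m * `|DF x (v, w)| ->
  `|DG x (v, w)| <= b' m * `|v| /\ `|DF x (v, w)| <= ls m * `|v|.
Proof.
have inc h := @cB m (x + h.1) x (G ((x, f (xm x)) + h)) (G (x, f (xm x)))
  (F ((x, f (xm x)) + h)) (F (x, f (xm x))) (f (xm x) + h.2) (f (xm x))
  (conj erefl erefl) (conj erefl erefl).
have Nfst (t : R) (z : (X m * Y (u m))%type) : 0 < t -> `|(t *: z).1| = t * `|z.1|.
  by move=> t0; rewrite normrZ gtr0_norm.
have Nsnd (t : R) (z : (X m * Y (u m))%type) : 0 < t -> `|(t *: z).2| = t * `|z.2|.
  by move=> t0; rewrite normrZ gtr0_norm.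
have {}inc h : `|h.2| <= b m * `|F ((x, f (xm x)) + h) - F (x, f (xm x))| ->
    `|G ((x, f (xm x)) + h) - G (x, f (xm x))| <= b' m * `|h.1| /\
    `|F ((x, f (xm x)) + h) - F (x, f (xm x))| <= ls m * `|h.1|.
  by have := inc h; rewrite [x + _ - _]addrC addKr [f _ + _ - _]addrC addKr.
move=> vw; split.
- exact: (differentiable_cone (FC1' x) (GC1' x) (bm0 m) Nsnd Nfst
    (fun h hh => (inc h hh).1) (v := (v, w)) vw).
- exact: (differentiable_cone (FC1' x) (FC1' x) (bm0 m) Nsnd Nfst
    (fun h hh => (inc h hh).2) (v := (v, w)) vw).
Qed.

(** The closed cone is needed because a field bounded by [b'] satisfies only a non-strict
    inequality, and [b' (u m)] may equal [b m]. *)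
Lemma tangent_corrB m (x v : X m) (w : Y (u m)) :
  `|w| <= b' (u m) * `|DF x (v, w)| ->
  `|DG x (v, w)| <= b' m * `|v| /\ `|DF x (v, w)| <= ls m * `|v|.
Proof.
apply: (@corrB _ _ _ _ _ (DF x) (DG x) (a m) (a' m) (lu m) (b m)) => //.
- exact: tangentA.
- exact: tangentB.
Qed.

Lemma tangent_robust m (x : X m) (c : R) : 0 <= c -> c <= a m -> c * b' m < 1 ->
  exists2 N, 0 <= N & forall e v w x' y, 0 < e ->
  `|v| <= c * `|y| + e -> `|x' - DF x (v, w)| <= e -> `|y - DG x (v, w)| <= e ->
  `|x'| <= a' m * `|w| + N * e /\ `|y| <= lu m * `|w| + N * e.
Proof.
move=> c0 ca cb.
apply: (@corrA_robust _ _ _ _ _ (DF x) (DG x) (a m) (a' m) (lu m) (b m) (b' m) (ls m)) => //.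
- exact: ltW.
- exact: tangentA.
- exact: tangentB.
Qed.

(* [T m x e s h w] reads: at scale [s] and up to a relative error controlled by
   [e], the displacement [(h, w)] at [(x, f x)] starts an approximate orbit of
   the correspondence linearized along the orbit of [x]. *)
Definition pseudo_orbits (T : forall m, X m -> R -> R -> X m -> Y m -> Prop) :=
  [/\ forall m x e s h w, T m x e s h w ->
        [/\ 0 < s, `|h| <= s & `|w| <= b' m * s],
      forall m x e, 0 < e -> exists2 d, 0 < d & forall s h w, T m x d s h w ->
        exists h1 w1, [/\ T (u m) (xm x) e (ls m * s) h1 w1,
          `|h1 - DF x (h, w1)| <= e * s & `|w - DG x (h, w1)| <= e * s],
      forall m x e s h w, T m x e s h w -> forall h', `|h'| <= s ->
        exists2 w', T m x e s h' w' & `|w' - w| <= b' m * `|h' - h| &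
      forall m x d e s h w, d <= e -> T m x d s h w -> T m x e s h w].

(** * First-order uniqueness of pseudo-orbits *)

Section Uniqueness.
Context (T T' : forall m, X m -> R -> R -> X m -> Y m -> Prop)
  (HT : pseudo_orbits T) (HT' : pseudo_orbits T').

(** The trivial bound on a difference of two fiber components, [n] steps ahead, contracted [n]
    times. *)
Let rho n m := q ^+ n * (2 * b' (iter n u m)).

(** Base components may differ by a cone of aperture [c]: equality of base components is not
    preserved by a step, so the induction needs this wider statement. *)
Let close n := forall m (x : X m) (c e : R), 0 <= c -> c <= a m -> c * b' m < 1 ->
  0 < e -> exists2 d, 0 < d & forall s h w v z,
  T x d s h w -> T' x d s v z -> `|h - v| <= c * `|w - z| + d * s ->
  `|w - z| <= (rho n m + e) * s.

(** The robust cone estimate puts the next displacements in a cone of aperture [a' m], up to an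
    error. The induction hypothesis at [xm x] bounds [w1 - z1], and pulling back to [w - z] costs
    [lu m]; the factors combine to [th m * ls m * lu m], at most [q]. *)
Lemma close_succ n : close n -> close n.+1.
Proof.
move=> IH m x c e c0 ca cb e0.
have [N N0 robust] := tangent_robust x c0 ca cb.
have [T1 T2 T3 Tm] := HT; have [T1' T2' T3' Tm'] := HT'.
pose p := rho n (u m); have p0 : 0 <= p.
  by rewrite mulr_ge0// ?exprn_ge0// mulr_ge0.
have lsm := ls0 m; have thm := th0 m; have lum := lu0 m; have b'm := b'0 (u m).
have a'm := a'0 m.
have k0 : 0 < lu m * (th m * ls m + 1) + 1.
  by rewrite ltr_wpDl// mulr_ge0// addr_ge0// mulr_ge0// ltW.
(* Half of [e] pays for the errors [e1] amplified by [lu m * (th m * ls m + 1)], the other half for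
   the robustness error [2 * N * eta]. *)
pose e1 := e / 2 / (lu m * (th m * ls m + 1) + 1).
have e10 : 0 < e1 by rewrite !divr_gt0.
have e1E : e1 * (lu m * (th m * ls m + 1) + 1) = e / 2.
  by rewrite divfK// gt_eqF.
have [eta [eta0 etaN step]] : exists eta, [/\ 0 < eta, 2 * N * eta <= e / 2 &
    forall s h1 w1 v1 z1, T (xm x) eta (ls m * s) h1 w1 ->
      T' (xm x) eta (ls m * s) v1 z1 ->
      `|h1 - v1| <= a' m * `|w1 - z1| + 2 * N * eta * s ->
      `|w1 - z1| <= th m * ((p + e1) * (ls m * s)) + e1 * s].
  case: (thE m) => [[a'a thE1]|thE1].
    (* Nested cones: [a' m] is itself an admissible aperture at the next point. *)
    have [d d0 Hd] := IH (u m) (xm x) (a' m) e1 a'm a'a (a'b' m) e10.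
    have k1 : 0 < Num.min (d * ls m) (e / 2) by rewrite lt_min !mulr_gt0 ?divr_gt0.
    have N20 : 0 <= 2 * N by rewrite mulr_ge0.
    have [eta [eta0 etad]] := small_pos d0 k1 N20.
    rewrite le_min => /andP[etak etae].
    exists eta; split=> // s h1 w1 v1 z1 Th Tv hv.
    have [s0 _ _] := T1 _ _ _ _ _ _ Th.
    have {}s0 : 0 < s by rewrite pmulr_rgt0 in s0.
    have := Hd _ _ _ _ _ (Tm _ _ _ _ _ _ _ etad Th) (Tm' _ _ _ _ _ _ _ etad Tv).
    rewrite thE1 mul1r => H; apply: (@le_trans _ _ ((p + e1) * (ls m * s))).
      apply: H; apply: le_trans hv _; rewrite lerD2l mulrA.
      by apply: ler_wpM2r => //; exact: ltW.
    by rewrite lerDl mulr_ge0// ltW.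
  (* The displacement [(v1, z1)] is replaced by one with base component [h1];
     this costs the factor [th m] but makes the next cone degenerate. *)
  have zb : 0 * b' (u m) < 1 by rewrite mul0r.
  have [d d0 Hd] := IH (u m) (xm x) 0 e1 (lexx 0) (a0 (u m)) zb e10.
  have k1 : 0 < Num.min e1 (e / 2) by rewrite lt_min e10 divr_gt0.
  have cc0 : 0 <= 2 * N * (th m * b' (u m) + 1).
    by rewrite mulr_ge0 ?mulr_ge0// addr_ge0// mulr_ge0// ltW.
  have [eta [eta0 etad]] := small_pos d0 k1 cc0.
  rewrite le_min => /andP[etak etae].
  have Neta : 0 <= N * eta by rewrite mulr_ge0// ltW.
  have tbN : 0 <= th m * b' (u m) * (N * eta) by rewrite mulr_ge0// mulr_ge0// ltW.
  exists eta; split=> //; first by move: etae tbN; lra.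
  move=> s h1 w1 v1 z1 Th Tv hv.
  have [s0 h1s _] := T1 _ _ _ _ _ _ Th.
  have {}s0 : 0 < s by rewrite pmulr_rgt0 in s0.
  have [z' Tz' zz'] := T3' _ _ _ _ _ _ Tv _ h1s.
  have wz' : `|w1 - z'| <= (p + e1) * (ls m * s).
    apply: (Hd _ _ _ _ _ (Tm _ _ _ _ _ _ _ etad Th) (Tm' _ _ _ _ _ _ _ etad Tz')).
    by rewrite subrr normr0 mul0r add0r mulr_ge0 ?(ltW d0)// mulr_ge0 ?ltW.
  have tri := ler_distD z' w1 z1.
  have bhv := ler_wpM2l b'm hv.
  (* [|z' - z1|] is at most [b' (u m) * a' m * |w1 - z1|] plus an error; moving this to the left
     leaves the gap, whose inverse is [th m]. *)
  have th1 : th m * (1 - a' m * b' (u m)) = 1.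
    by rewrite thE1 mulVf// gt_eqF// subr_gt0.
  have H : (1 - a' m * b' (u m)) * `|w1 - z1| <=
      `|w1 - z'| + b' (u m) * (2 * N * eta * s).
    by move: tri bhv zz'; lra.
  rewrite -[leLHS]mul1r -th1 -mulrA.
  apply: le_trans (ler_wpM2l (ltW thm) H) _; rewrite mulrDr; apply: lerD.
    by apply: ler_wpM2l => //; exact: ltW.
  have -> : th m * (b' (u m) * (2 * N * eta * s)) =
    2 * (th m * b' (u m) * (N * eta)) * s by ring.
  apply: ler_wpM2r; first exact: ltW.
  by move: etak Neta; lra.
have [d1 d10 step1] := T2 m x _ eta0; have [d2 d20 step2] := T2' m x _ eta0.
(* Each family makes its step with error [eta], so the differences have error [2 * eta]; the first
   entry keeps the error of the cone hypothesis below that too. *)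
exists (Num.min (2 * eta) (Num.min d1 d2)).
  by rewrite !lt_min d10 d20 mulr_gt0.
move=> s h w v z Th Tv hv; set d := Num.min _ _ in Th Tv hv.
have /andP[deta /andP[dd1 dd2]] : (d <= 2 * eta) && ((d <= d1) && (d <= d2)).
  by rewrite -!le_min.
have [s0 _ _] := T1 _ _ _ _ _ _ Th.
have [h1 [w1 [Th1 h1E wE]]] := step1 _ _ _ (Tm _ _ _ _ _ _ _ dd1 Th).
have [v1 [z1 [Tv1 v1E zE]]] := step2 _ _ _ (Tm' _ _ _ _ _ _ _ dd2 Tv).
have eps0 : 0 < 2 * eta * s by rewrite !mulr_gt0.
have [] := robust (2 * eta * s) (h - v) (w1 - z1) (h1 - v1) (w - z) eps0.
- apply: le_trans hv _; rewrite lerD2l; apply: ler_wpM2r => //; exact: ltW.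
- by rewrite linear_pairB -mulrA; exact: ler_dist_dist2.
- by rewrite linear_pairB -mulrA; exact: ler_dist_dist2.
move=> hv1 wz.
have {hv1}hv1 : `|h1 - v1| <= a' m * `|w1 - z1| + 2 * N * eta * s.
  by move: hv1; lra.
have := ler_wpM2l lum (step _ _ _ _ _ Th1 Tv1 hv1).
have rhoS : rho n.+1 m = q * p by rewrite /p /rho exprS iterSr -mulrA.
have : lu m * (th m * (p * (ls m * s))) <= q * p * s.
  have -> : lu m * (th m * (p * (ls m * s))) = th m * ls m * lu m * (p * s) by ring.
  by rewrite -[leRHS]mulrA; apply: ler_wpM2r => //; rewrite mulr_ge0// ltW.
have e1s : 0 < e1 * s by rewrite mulr_gt0.
move: wz e1s (ler_wpM2r (ltW s0) etaN) (congr1 (fun r => r * s) e1E).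
by rewrite rhoS; lra.
Qed.

(** The size bounds on pseudo-orbits start the induction on [close], and [rho] tends to 0 because
    [q < 1]. Equal base components allow aperture 0. *)
Lemma pseudo_orbits_unique m (x : X m) (e : R) : 0 < e -> exists2 d, 0 < d &
  forall s h w z, T x d s h w -> T' x d s h z -> `|w - z| <= e * s.
Proof.
move=> e0; have [T1 _ _ _] := HT; have [T1' _ _ _] := HT'.
have Hclose n : close n.
  elim: n => [|n]; last exact: close_succ.
  move=> {x e e0}m x c e c0 ca cb e0; exists 1 => // s h w v z Th Tv _.
  have [s0 _ ws] := T1 _ _ _ _ _ _ Th; have [_ _ zs] := T1' _ _ _ _ _ _ Tv.
  have := ler_normB w z; rewrite /rho expr0 mul1r /=.
  have : 0 < e * s by rewrite mulr_gt0.
  lra.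
have C0 : 0 <= C by apply: le_trans (b'C m).
(* At least one step is taken, since [C] bounds [b'] only on the image of [u]. *)
have [n rho_small] : exists n, rho n.+1 m <= e / 2.
  have C1 : 0 < 2 * C + 1 by rewrite ltr_wpDl// mulr_ge0.
  have qcvg : q ^+ n @[n --> \oo] --> (0 : R) by apply: cvg_expr; rewrite ger0_norm.
  have e2C : 0 < e / 2 / (2 * C + 1) by rewrite !divr_gt0.
  move/cvgr0Pnorm_le: qcvg => /(_ _ e2C)[N _ /(_ N.+1 (leqnSn N))].
  rewrite /= ger0_norm ?exprn_ge0// ler_pdivlMr// => qN.
  exists N; apply: le_trans qN; apply: ler_wpM2l; first exact: exprn_ge0.
  by rewrite iterS; have := b'C (iter N u m); lra.
have e20 : 0 < e / 2 by rewrite divr_gt0.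
have zb : 0 * b' m < 1 by rewrite mul0r.
have [d d0 Hd] := Hclose n.+1 m x 0 (e / 2) (lexx 0) (a0 m) zb e20.
exists d => // s h w z Th Tv; have [s0 _ _] := T1 _ _ _ _ _ _ Th.
apply: le_trans (Hd _ _ _ _ _ Th Tv _) _.
  by rewrite subrr normr0 mul0r add0r mulr_ge0// ltW.
apply: ler_wpM2r; [exact: ltW|lra].
Qed.

End Uniqueness.

(** * Increments of [f] and values of an invariant field as pseudo-orbits; the derivative *)

Definition increments m (x : X m) (e s : R) (h : X m) (w : Y m) :=
  [/\ 0 < s, s <= e, `|h| <= s & w = f (x + h) - f x].

(** By the invariance [fE], increments of [xm] and [f] are increments of [F] and [G], which follow
    the linearization for small displacements. This is why the precision [e] caps the scale [s]. *)
Lemma pseudo_orbits_increments : pseudo_orbits increments.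
Proof.
split.
- move=> m x e s h w [s0 _ hs ->]; split=> //.
  apply: le_trans (flip _ _) _; rewrite addrC addKr.
  exact: ler_wpM2l.
- move=> m x e e0; have lsm := ls0 m.
  (* [k * s] dominates both the norm of [(h, w1)] and the next scale [ls m * s], so one smallness
     condition serves all three requirements. *)
  pose k := 1 + b' (u m) * ls m + ls m.
  have bls : 0 <= b' (u m) * ls m by rewrite mulr_ge0// ltW.
  have k0 : 0 < k by rewrite /k; lra.
  have ek0 : 0 < e / k by rewrite divr_gt0.
  have [d1 d10 H1] := differentiable_norm_le (FC1' x) ek0.
  have [d2 d20 H2] := differentiable_norm_le (GC1' x) ek0.
  have dmin : 0 < Num.min e (Num.min d1 d2) by rewrite !lt_min e0 d10.
  have [d [d0 _ kd]] := small_pos dmin dmin (ltW k0).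
  exists d => // s h w [s0 sd hs ->].
  have [dE1 dE2 dE3] : [/\ k * s <= e, k * s <= d1 & k * s <= d2].
    have : k * s <= Num.min e (Num.min d1 d2).
      by apply: le_trans kd; rewrite ler_pM2l.
    by rewrite !le_min => /and3P[].
  have [Fx Gx] := fE x; have [Fh Gh] := fE (x + h).
  pose h1 := xm (x + h) - xm x; pose w1 := f (xm (x + h)) - f (xm x).
  have h1s : `|h1| <= ls m * s.
    apply: le_trans (xmlip _ _) _; rewrite addrC addKr.
    by rewrite ler_pM2l.
  have w1s : `|w1| <= b' (u m) * (ls m * s).
    by apply: le_trans (flip _ _) _; exact: ler_wpM2l.
  have hw1 : `|(h, w1)| <= k * s.
    have bs : 0 <= b' (u m) * (ls m * s) by rewrite !mulr_ge0// ltW.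
    have lss : 0 <= ls m * s by rewrite mulr_ge0// ltW.
    by apply: pair_norm_le; rewrite /k; lra.
  have ptE : (x, f (xm x)) + (h, w1) = (x + h, f (xm (x + h))).
    by apply: injective_projections => //=; rewrite /w1 addrC subrK.
  have small : e / k * `|(h, w1)| <= e * s.
    apply: (@le_trans _ _ (e / k * (k * s))); first by rewrite ler_pM2l.
    by rewrite mulrA divfK// gt_eqF.
  exists h1, w1; split.
  + split=> //; first exact: mulr_gt0.
      by apply: le_trans dE1; rewrite ler_pM2r// /k; lra.
    by rewrite /w1 /h1 [xm x + _]addrC subrK.
  + apply: le_trans small; have := H1 (h, w1) (le_trans hw1 dE2).
    by rewrite ptE Fh Fx.
  + apply: le_trans small; have := H2 (h, w1) (le_trans hw1 dE3).
    by rewrite ptE Gh Gx.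
- move=> m x e s h w [s0 se hs ->] h' hs'; exists (f (x + h') - f x) => //.
  rewrite opprB addrA subrK; apply: le_trans (flip _ _) _.
  by rewrite opprD addrACA subrr add0r.
- by move=> m x d e s h w de [s0 sd hs ->]; split=> //; exact: le_trans de.
Qed.

Section InvariantField.
Context (K : forall m, X m -> bounded_op (X m) (Y m))
  (Q : forall m, X m -> bounded_op (X m) (X (u m))).
Context (Kb' : forall m (x v : X m), `|K x v| <= b' m * `|v|).
Context (KQ : forall m (x v : X m), DF x (v, K (xm x) (Q x v)) = Q x v /\
                                    DG x (v, K (xm x) (Q x v)) = K x v).

Definition nearby_linear m (x : X m) (e s : R) (h : X m) (w : Y m) :=
  [/\ 0 < s, `|h| <= s & exists2 x', `|x' - x| <= e & w = K x' h].

(** Values of [K] at [x'] form an exact orbit of the linearization at [x']. Continuity of the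
    differentials of [F] and [G] turns it into an approximate one at [x], so the precision measures
    the distance from [x'] to [x]. *)
Lemma pseudo_orbits_nearby_linear : pseudo_orbits nearby_linear.
Proof.
split.
- move=> m x e s h w [s0 hs [x' _ ->]]; split=> //.
  by apply: le_trans (Kb' _ _) _; exact: ler_wpM2l.
- move=> m x e e0; have lsm := ls0 m; have b'm := b'0 (u m).
  pose k := 1 + b' (u m) * ls m + ls m.
  have bls : 0 <= b' (u m) * ls m by rewrite mulr_ge0// ltW.
  have k0 : 0 < k by rewrite /k; lra.
  have ek0 : 0 < e / k by rewrite divr_gt0.
  have [d1 d10 H1] := C1_norm_le (x, f (xm x)) (FC1 m) ek0.
  have [d2 d20 H2] := C1_norm_le (x, f (xm x)) (GC1 m) ek0.
  have dmin : 0 < Num.min e (Num.min d1 d2) by rewrite !lt_min e0 d10.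
  have [d [d0 _ kd]] := small_pos dmin dmin (ltW k0).
  exists d => // s h w [s0 hs [x' x'd ->]].
  have [dE1 dE2 dE3] : [/\ k * d <= e, k * d <= d1 & k * d <= d2].
    by move: kd; rewrite !le_min => /and3P[].
  have [QE KE] := KQ x' h.
  pose h1 := Q x' h; pose w1 := K (xm x') h1.
  have h1s : `|h1| <= ls m * s.
    (* No bound on [Q] is assumed; it follows from the closed cone condition, as [w1] is the image
       of [Q x' h] under [K]. *)
    have [|_] := @tangent_corrB m x' h w1; first by rewrite QE; exact: Kb'.
    by rewrite QE => /le_trans; apply; rewrite ler_pM2l.
  have w1s : `|w1| <= b' (u m) * (ls m * s).
    by apply: le_trans (Kb' _ _) _; exact: ler_wpM2l.
  have hw1 : `|(h, w1)| <= k * s.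
    have bs : 0 <= b' (u m) * (ls m * s) by rewrite !mulr_ge0// ltW.
    have lss : 0 <= ls m * s by rewrite mulr_ge0// ltW.
    by apply: pair_norm_le; rewrite /k; lra.
  have small : e / k * `|(h, w1)| <= e * s.
    apply: (@le_trans _ _ (e / k * (k * s))); first by rewrite ler_pM2l.
    by rewrite mulrA divfK// gt_eqF.
  have xm'd : `|xm x' - xm x| <= ls m * d.
    by apply: le_trans (xmlip _ _) _; rewrite ler_pM2l.
  have lsd : 0 <= ls m * d by rewrite mulr_ge0// ltW.
  have blsd : 0 <= b' (u m) * (ls m * d) by rewrite mulr_ge0.
  have ptd : `|(x', f (xm x')) - (x, f (xm x))| <= k * d.
    apply: pair_norm_le; first by apply: le_trans x'd _; rewrite /k; lra.
    apply: le_trans (flip _ _) _; apply: le_trans (ler_wpM2l b'm xm'd) _.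
    by rewrite /k; lra.
  exists h1, w1; split.
  + split=> //; first exact: mulr_gt0.
    by exists (xm x') => //; apply: le_trans xm'd _; rewrite /k in dE1; lra.
  + apply: le_trans small; have := H1 _ (le_trans ptd dE2) (h, w1).
    by rewrite [X in `|X - _|]QE.
  + apply: le_trans small; have := H2 _ (le_trans ptd dE3) (h, w1).
    by rewrite [X in `|X - _|]KE.
- move=> m x e s h w [s0 hs [x' x'e ->]] h' hs'; exists (K x' h').
    by split=> //; exists x'.
  by rewrite -linearB; exact: Kb'.
- move=> m x d e s h w de [s0 hs [x' x'd ->]]; split=> //.
  by exists x' => //; exact: le_trans de.
Qed.

Lemma invariant_field_is_derivative m :
  C1 (@f m) /\ forall x, 'd (@f m) x = K x :> (X m -> Y m).
Proof.
have dK (x : X m) : differentiable (@f m) x /\ 'd (@f m) x = K x :> (X m -> Y m).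
  apply: differentiable_of_norm_le; first exact: bounded_op_cont.
  (* At scale [|h|], first-order agreement of the increment of [f] with [K x h] is
     differentiability. *)
  move=> e e0; have [d d0 Hd] := pseudo_orbits_unique pseudo_orbits_increments
    pseudo_orbits_nearby_linear x e0.
  exists d => // h hd; have [->|h0] := eqVneq h 0.
    by rewrite addr0 subrr linear0 subrr !normr0 mulr0.
  have {}h0 : 0 < `|h| by rewrite normr_gt0.
  apply: Hd; first by split.
  by split=> //; exists x => //; rewrite subrr normr0 ltW.
split; last by move=> x; case: (dK x).
split; first by move=> x; case: (dK x).
move=> x.
suff : opnorm (K y \- K x) @[y --> x] --> 0%E.
  under eq_fun do rewrite -(dK _).2 -(dK x).2; exact.
apply: (cvg_opnorm0 (T := fun y => K y \- K x)) => e e0.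
(* Comparing [K y h] with [K x h], both as pseudo-orbits at [x], gives continuity of [K] in operator
   norm. *)
have [d d0 Hd] := pseudo_orbits_unique pseudo_orbits_nearby_linear
    pseudo_orbits_nearby_linear x e0.
exists d => // y yd h; have [->|h0] := eqVneq h 0.
  by rewrite linear0 !normr0 mulr0.
have {}h0 : 0 < `|h| by rewrite normr_gt0.
apply: Hd; first by split=> //; exists y.
by split=> //; exists x => //; rewrite subrr normr0 ltW.
Qed.

End InvariantField.

(** * Existence of the invariant field by Picard iteration of the graph transform *)

Lemma invariant_field_exists :
  exists (K : forall m, X m -> bounded_op (X m) (Y m))
    (Q : forall m, X m -> bounded_op (X m) (X (u m))),
  (forall m (x v : X m), `|K m x v| <= b' m * `|v|) /\
  (forall m (x v : X m), DF x (v, K (u m) (xm x) (Q m x v)) = Q m x v /\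
                         DG x (v, K (u m) (xm x) (Q m x v)) = K m x v).
Proof.
pose field := forall m, X m -> bounded_op (X m) (Y m).
pose bounded (K : field) := forall m (x v : X m), `|K m x v| <= b' m * `|v|.
pose transforms (K K' : field) (Q : forall m, X m -> bounded_op (X m) (X (u m))) :=
  forall m (x v : X m), [/\ DF x (v, K (u m) (xm x) (Q m x v)) = Q m x v,
    DG x (v, K (u m) (xm x) (Q m x v)) = K' m x v,
    `|Q m x v| <= ls m * `|v| & `|K' m x v| <= b' m * `|v|].
have transform (K : field) : bounded K -> exists K' Q, transforms K K' Q.
  move=> Kb.
  have ex m (x : X m) : exists QL : bounded_op (X m) (X (u m)) * bounded_op (X m) (Y m),
      forall v, [/\ DF x (v, K (u m) (xm x) (QL.1 v)) = QL.1 v,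
      DG x (v, K (u m) (xm x) (QL.1 v)) = QL.2 v,
      `|QL.1 v| <= ls m * `|v| & `|QL.2 v| <= b' m * `|v|].
    have [||||||Q [L QL]] := @graph_transform _ _ _ _ _ (DF x) (DG x)
      (K (u m) (xm x)) (a' m) (b' (u m)) (b' m) (ls m) => //.
    - by move=> w; have [|] := @tangentA m x 0 w; first by left; rewrite normr0.
    - by move=> v w; exact: tangent_corrB.
    - by exists (Q, L).
  exists (fun m x => (projT1 (cid (ex m x))).2),
    (fun m x => (projT1 (cid (ex m x))).1).
  by move=> m x; case: (cid (ex m x)).
(* Stated for all fields, with [K] as default value for unbounded ones, so that [choice] yields a
   map that can be iterated. *)
have step (K : field) : exists K', bounded K -> exists Q, transforms K K' Q.
  have [Kb|nKb] := pselect (bounded K); last by exists K.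
  by have [K' HK'] := transform _ Kb; exists K' => _; exact: HK'.
have [next nextE] := choice step.
have zero_lin m : linear (fun _ : X m => 0 : Y m) by move=> k v w; rewrite scaler0 addr0.
have zero_le m (v : X m) : `|0 : Y m| <= 0 * `|v| by rewrite normr0 mul0r.
pose K0 : field := fun m x => sval (bounded_op_of_map (zero_lin m) (zero_le m)).
pose Kn n := iter n next K0.
have Knb n : bounded (Kn n).
  elim: n => [|n IH] m x v.
    by rewrite /Kn /= /K0; case: bounded_op_of_map => T /= ->; rewrite normr0 mulr_ge0.
  by have [Q /(_ m x v) []] := nextE _ IH.
(* A step of the correspondence leads from iterate [n.+1] to iterate [n] without error, so the
   precision only has to ensure that enough steps remain: [n] is at least [1 / e]. *)
pose T m (x : X m) (e s : R) (h : X m) (w : Y m) :=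
  [/\ 0 < s, `|h| <= s & exists2 n, 1 <= n%:R * e & w = Kn n m x h].
have HT : pseudo_orbits T.
  split.
  - move=> m x e s h w [s0 hs [n _ ->]]; split=> //.
    by apply: le_trans (Knb _ _ _ _) _; exact: ler_wpM2l.
  - move=> m x e e0; have e1 : 0 < 1 + e by lra.
    (* Its inverse is [1 + 1 / e], which allows for the loss of one iterate and excludes index 0. *)
    exists (e / (1 + e)); first by rewrite divr_gt0.
    move=> s h w [s0 hs [n ne ->]].
    case: n ne => [|n]; first by rewrite mul0r; lra.
    rewrite mulrA ler_pdivlMr// mul1r mulrSr mulrDl mul1r lerD2r => ne.
    have [Q /(_ m x h)[QE KE Qs Ks]] := nextE _ (Knb n).
    exists (Q m x h), (Kn n (u m) (xm x) (Q m x h)); split.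
    + split; [exact: mulr_gt0| |by exists n].
      by apply: le_trans Qs _; rewrite ler_pM2l.
    + by rewrite QE subrr normr0 mulr_ge0// ltW.
    + by rewrite KE /= subrr normr0 mulr_ge0// ltW.
  - move=> m x e s h w [s0 hs [n ne ->]] h' hs'; exists (Kn n m x h').
      by split=> //; exists n.
    by rewrite -linearB; exact: Knb.
  - move=> m x d e s h w de [s0 hs [n nd ->]]; split=> //; exists n => //.
    by apply: le_trans nd _; exact: ler_wpM2l.
have Kcauchy m (x : X m) (e : R) : 0 < e -> exists N, forall k l,
    (N <= k)%N -> (N <= l)%N -> forall v, `|Kn k m x v - Kn l m x v| <= e * `|v|.
  move=> e0; have [d d0 Hd] := pseudo_orbits_unique HT HT x e0.
  have [N HN] : exists N : nat, forall k, (N <= k)%N -> 1 <= k%:R * d.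
    exists (Num.truncn d^-1).+1 => k Nk; rewrite -ler_pdivrMr// mul1r.
    by apply: le_trans (ltW (truncnS_gt _)) _; rewrite ler_nat.
  exists N => k l Nk Nl v; have [->|v0] := eqVneq v 0.
    by rewrite [Kn k m x 0]linear0 [Kn l m x 0]linear0 subrr !normr0 mulr0.
  have {}v0 : 0 < `|v| by rewrite normr_gt0.
  by apply: Hd; split=> //; [exists k|exists l] => //; exact: HN.
have Klim m (x : X m) : exists L : bounded_op (X m) (Y m),
    (forall v, `|L v| <= b' m * `|v|) /\ forall e, 0 < e -> exists N, forall k,
    (N <= k)%N -> forall v, `|Kn k m x v - L v| <= e * `|v|.
  apply: (bounded_op_complete (T := fun k => Kn k m x)).
    by move=> k v; exact: Knb.
  by move=> e; exact: Kcauchy.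
pose K : field := fun m x => projT1 (cid (Klim m x)).
have Kb : bounded K by move=> m x; exact: (projT2 (cid (Klim m x))).1.
have KnK m (x : X m) (e : R) : 0 < e -> exists N, forall k,
    (N <= k)%N -> forall v, `|Kn k m x v - K m x v| <= e * `|v|.
  exact: (projT2 (cid (Klim m x))).2.
(* It remains to see that the transform [K'] of the limit is [K]: it is compared with iterate
   [n.+1], the transform of iterate [n]. *)
have [K' [Q KQ]] := transform _ Kb; exists K, Q; split=> // m x v.
have [QE K'E Qs _] := KQ m x v; split=> //; rewrite K'E.
apply/eqP; rewrite -subr_eq0 -normr_le0.
have t0 : 0 < 1 - a' m * b' (u m) by rewrite subr_gt0.
rewrite -(pmulr_rle0 _ t0); apply/ler_addgt0Pr => e e0; rewrite add0r.
have k0 : 0 <= (lu m * ls m + 1) * `|v|.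
  by rewrite mulr_ge0// addr_ge0// mulr_ge0// ltW.
have [e1 [e10 _ ke1]] := small_pos e0 e0 k0.
have [N1 H1] := KnK m x _ e10; have [N2 H2] := KnK (u m) (xm x) _ e10.
pose n := maxn N1 N2.
have {}H1 := H1 n.+1 (leqW (leq_maxl _ _)) v.
have [Qn /(_ m x v)[QnE KnE Qns _]] := nextE _ (Knb n).
have {}H2 := H2 n (leq_maxr _ _) (Qn m x v).
pose D := Kn n (u m) (xm x) (Qn m x v) - K (u m) (xm x) (Q m x v).
have [|QD KD] := @tangentA m x 0 D; first by left; rewrite normr0.
have QnQ : `|Qn m x v - Q m x v| <= a' m * `|D|.
  by rewrite -QnE -QE -linear_pairB subrr.
have KnK' : `|Kn n.+1 m x v - K' m x v| <= lu m * `|D|.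
  by rewrite -[Kn n.+1 m x v]KnE -K'E -linear_pairB subrr.
(* [D] also occurs on the right, through [Qn - Q]; it is absorbed because [a' m * b' (u m) < 1]. *)
have DE : `|D| <= e1 * `|Qn m x v| + b' (u m) * (a' m * `|D|).
  apply: le_trans (ler_distD (K (u m) (xm x) (Qn m x v)) _ _) _.
  apply: lerD => //; rewrite -linearB; apply: le_trans (Kb _ _ _) _.
  exact: ler_wpM2l.
have := ler_distD (Kn n.+1 m x v) (K' m x v) (K m x v).
rewrite [`|K' m x v - Kn _ _ _ _|]distrC => tri.
have e1Q := ler_wpM2l (ltW e10) Qns.
have tD : (1 - a' m * b' (u m)) * `|D| <= e1 * (ls m * `|v|) by lra.
have ab0 : 0 <= a' m * b' (u m) by rewrite mulr_ge0.
have e1v : 0 <= a' m * b' (u m) * (e1 * `|v|) by rewrite mulr_ge0// mulr_ge0// ltW.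
have luD := ler_wpM2l (lu0 m) tD.
have tK : `|K' m x v - K m x v| <= lu m * `|D| + e1 * `|v| by lra.
have := ler_wpM2l (ltW t0) tK.
lra.
Qed.

Lemma invariant_derivative_eqs (K : forall m, X m -> bounded_op (X m) (Y m)) :
  invariant_derivative F G b' f xm K <->
  (forall m (x v : X m), `|K m x v| <= b' m * `|v|) /\
  exists Q : forall m, X m -> bounded_op (X m) (X (u m)),
  forall m (x v : X m), DF x (v, K (u m) (xm x) (Q m x v)) = Q m x v /\
                        DG x (v, K (u m) (xm x) (Q m x v)) = K m x v.
Proof.
by split=> -[Kb KQ]; split=> // m x;
  [apply/(opnorm_leP _ (b'0 m))|apply/opnorm_leP].
Qed.

(** Uniqueness of [K] comes for free: every invariant field is the derivative of the same [f]. *)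
Lemma invariant_map_C1 :
  (exists! K : forall m, X m -> bounded_op (X m) (Y m),
     invariant_derivative F G b' f xm K) /\
  (forall K : forall m, X m -> bounded_op (X m) (Y m),
     invariant_derivative F G b' f xm K ->
     forall m, C1 (@f m) /\ forall x, 'd (@f m) x = K m x :> (X m -> Y m)).
Proof.
have derivativeE K : invariant_derivative F G b' f xm K ->
    forall m, C1 (@f m) /\ forall x, 'd (@f m) x = K m x :> (X m -> Y m).
  move=> /invariant_derivative_eqs[Kb [Q KQ]] m.
  exact: (invariant_field_is_derivative Kb KQ).
split=> //; have [K [Q [Kb KQ]]] := invariant_field_exists.
have HK : invariant_derivative F G b' f xm K.
  by apply/invariant_derivative_eqs; split=> //; exists Q.
exists K; split=> // K' HK'.
apply: functional_extensionality_dep => m.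
apply: functional_extensionality_dep => x; apply: bounded_op_ext => v.
by rewrite -(derivativeE K HK m).2 -(derivativeE K' HK' m).2.
Qed.

End InvariantGraph.

(* Enlarging [lambda_s] keeps (B) and the spectral gap, so it may be assumed
   positive. *)
Lemma positive_contraction_rate (R : realType) (M : Type) (th ls lu : M -> R) :
  (forall m, 0 <= th m) -> (forall m, 0 <= lu m) -> (forall m, 0 <= ls m) ->
  (sup_fun (fun m => th m * ls m * lu m)%R < 1)%E ->
  exists ls' q, [/\ forall m, 0 < ls' m, forall m, ls m <= ls' m,
    0 <= q, q < 1 & forall m, th m * ls' m * lu m <= q].
Proof.
move=> th0 lu0 ls0 /sup_fun_lt[r]; rewrite lte_fin => r1 rle.
pose q := Num.max r 0; have q1 : q < 1 by rewrite gt_max r1 ltr01.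
have q0 : 0 <= q by rewrite le_max lexx orbT.
have k1 m : 0 < th m * lu m + 1 by rewrite ltr_wpDl// mulr_ge0.
exists (fun m => ls m + (1 - q) / 2 / (th m * lu m + 1)), ((1 + q) / 2).
have c0 m : 0 < (1 - q) / 2 / (th m * lu m + 1).
  by rewrite !divr_gt0// subr_gt0.
split.
- by move=> m; rewrite ltr_wpDl.
- by move=> m; rewrite lerDl ltW.
- by rewrite divr_ge0// addr_ge0.
- by rewrite ltr_pdivrMr//; lra.
move=> m; have rq : th m * ls m * lu m <= q.
  by apply: le_trans (rle m) _; rewrite le_max lexx.
have cE : (1 - q) / 2 / (th m * lu m + 1) * (th m * lu m + 1) = (1 - q) / 2.
  by rewrite divfK// gt_eqF.
move: (c0 m) cE => /=; set c : R := (1 - q) / 2 / _ => cm cE.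
have -> : th m * (ls m + c) * lu m = th m * ls m * lu m + (c * (th m * lu m + 1) - c).
  by ring.
by rewrite cE; lra.
Qed.

(** * Reduction of both alternatives to a single setting *)

Theorem lemma6p7 (R : realType) (M : Type)
  (X Y : M -> completeNormedModType R) (u : M -> M)
  (F : forall m, X m * Y (u m) -> X (u m))
  (G : forall m, X m * Y (u m) -> Y m)
  (alpha alpha' beta beta' lambda_s lambda_u theta : M -> R)
  (iX : forall m, X m) (iY : forall m, Y m)
  (f : forall m, X m -> Y m) (xm : forall m, X m -> X (u m)) :
  nonneg_fun alpha -> nonneg_fun alpha' ->
  nonneg_fun beta -> nonneg_fun beta' ->
  nonneg_fun lambda_s -> nonneg_fun lambda_u ->
  hypI F G alpha beta beta' lambda_s lambda_u theta \/
  hypII F G alpha alpha' beta beta' lambda_s lambda_u theta ->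
  (sup_fun (fun m => theta m * lambda_s m * lambda_u m)%R < 1)%E ->
  invariant_section F G iX iY ->
  invariant_map F G beta' lambda_s iX iY f xm ->
  (forall m, C1 (F m)) -> (forall m, C1 (G m)) ->
  (exists! K : forall m, X m -> bounded_op (X m) (Y m),
     invariant_derivative F G beta' f xm K) /\
  (forall K : forall m, X m -> bounded_op (X m) (Y m),
     invariant_derivative F G beta' f xm K ->
     forall m, C1 (f m) /\ forall x, 'd (f m) x = K m x :> (X m -> Y m)).
Proof.
move=> a0 a'0 b0 b'0 ls0 lu0 hyp rate _ inv FC1 GC1.
have [C b'b b'C] : exists2 C : R, (forall m, beta' (u m) <= beta m) &
    forall m, beta' (u m) <= C.
  by case: hyp => [[_ _ bb /sup_fun_lt[C _ HC] _]|
      [_ _ [_ bb] /sup_fun_lt[C _ HC] _]]; exists C => // m;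
    apply: le_trans (le_trans (bb m) _) (HC m); rewrite le_max lexx orbT.
have [A [A' [A0 A'0 cA A'b' thE]]] : exists A A', [/\ nonneg_fun A,
    nonneg_fun A', condA F G A A' lambda_u, forall m, A' m * beta' (u m) < 1 &
    forall m, (A' m <= A (u m) /\ theta m = 1) \/
              theta m = (1 - A' m * beta' (u m))^-1].
  case: hyp => [[[cA _] /sup_fun_lt[r r1 Hr] _ _ thE]|
      [[cA _] /sup_fun_lt[r r1 Hr] [ord _] _ thE]].
  (* (A') is (A) for cones of aperture 0, where the hypothesis forces equal base points; [alpha]
     then takes the role of [alpha']. *)
  - exists (fun=> 0), alpha; split=> //; last by right.
    + move=> m x1 x1' y1 y1' x2 x2' y2 y2' [/= -> ->] [/= -> ->].
      rewrite mul0r normr_le0 subr_eq0 => /eqP ->.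
      have [LF LG] := cA m x1'.
      by split; [exact: (LF (y2, y2'))|exact: (LG (y2, y2'))].
    + by move=> m; apply: le_lt_trans (Hr m) _; rewrite -lte_fin.
  - exists alpha, alpha'; split=> //; last by left.
    by move=> m; apply: le_lt_trans (Hr m) _; rewrite -lte_fin.
have th0 m : 0 <= theta m.
  by case: (thE m) => [[_ ->]//|->]; rewrite invr_ge0 subr_ge0 ltW.
(* Each step multiplies the scale of a pseudo-orbit by the rate [ls], which must be positive for the
   scale to remain so. *)
have [ls [q [lsp lsle q0 q1 thq]]] := positive_contraction_rate th0 lu0 ls0 rate.
apply: (@invariant_map_C1 R M X Y u F G A A' beta beta' ls lambda_u theta q C).
all: try by [].
- move=> m x1 x1' y1 y1' x2 x2' y2 y2' H H' yx.
  have cB : condB F G beta beta' lambda_s by case: hyp => -[[]].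
  have [H1 H2] := cB _ _ _ _ _ _ _ _ _ H H' yx; split=> //.
  by apply: le_trans H2 _; exact: ler_wpM2r.
- by move=> m x; have [_ _ _] := inv m; apply.
- by move=> m x x'; have [Lf _ _ _] := inv m; exact: (Lf (x, x')).
- move=> m x x'; have [_ _ Lx _] := inv m.
  by apply: le_trans (Lx (x, x') _) _ => //=; exact: ler_wpM2r.
Qed.
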